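(* The second Gelfand-Fuks cohomology group $H^2_{GF}(\mathrm{Vect}(S^1);\mathbb{R})$ is one-dimensional, and it is generated by the class of the Virasoro cocycle $$\mathrm{vir}(u,v)=\int_{S^1}(u'v''-v'u'')\,dx .$$
   Context: $\mathrm{Vect}(S^1)\cong C^\infty(S^1)$ (smooth real $2\pi$-periodic functions) is the Lie algebra with bracket $[u,v]=uv'-u'v$, where $'$ denotes $d/dx$. A $p$-cochain (alternating $p$-linear map $\gamma:\mathrm{Vect}(S^1)^p\to\mathbb{R}$) is called local if $\gamma(u_1,\dots,u_p)=\int_{S^1}P(u_1,\dots,u_p)\,dx$ for some $p$-linear differential operator $P$ with smooth coefficients. The coboundary operator is $$\partial\gamma(u_0,\dots,u_p)=\sum_{i<j}(-1)^{i+j}\gamma([u_i,u_j],u_0,\dots,\widehat{u_i},\dots,\widehat{u_j},\dots,u_p),$$ so $\partial\gamma(u,v)=-\gamma([u,v])$ for $1$-cochains and $\partial\gamma(u,v,w)=-\gamma([u,v],w)-\gamma([v,w],u)-\gamma([w,u],v)$ for $2$-cochains. It maps local cochains to local cochains and $\partial\circ\partial=0$. The Gelfand-Fuks cohomology $H^p_{GF}(\mathrm{Vect}(S^1);\mathbb{R})$ is the cohomology of the complex of local cochains: local $p$-cochains $\gamma$ with $\partial\gamma=0$ modulo those of the form $\partial\mu$ with $\mu$ a local $(p-1)$-cochain. *)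

(* Defs.v *)
From HB Require Import structures.
From mathcomp Require Import all_boot all_order all_algebra.
From mathcomp Require Import generic_quotient ring_quotient.
From mathcomp Require Import all_classical all_reals all_analysis.

Set Implicit Arguments.
Unset Strict Implicit.
Unset Printing Implicit Defensive.

Import Order.TTheory GRing.Theory Num.Theory.
Import numFieldNormedType.Exports.
Import Quotient.

Local Open Scope classical_set_scope.
Local Open Scope ring_scope.

(* In [ring_scope] these notations otherwise denote derivatives of polynomials. *)
Local Notation "f ^` ()" := (derive1 f) : ring_scope.
Local Notation "f ^` ( n )" := (derive1n n f) : ring_scope.

(* The library quotients an additive group by a subgroup; the quotient by a
   submodule also gets the induced scalar multiplication. *)

Section QuotientLmodule.
Variables (K : pzRingType) (V : lmodType K) (I : submodClosed V).

Definition submod_pred : {pred V} := I.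

Fact submod_pred_zmod : zmod_closed submod_pred.
Proof. exact: GRing.submod_closedB (submodClosedP I). Qed.

HB.instance Definition _ := GRing.isZmodClosed.Build V submod_pred
  submod_pred_zmod.

Definition quotmod : Type := {quot submod_pred}.

HB.instance Definition _ := ZmodQuotient.on quotmod.

Definition quotmod_pi (v : V) : quotmod := \pi_quotmod%qT v.

Lemma quotmod_piP v w : quotmod_pi v = quotmod_pi w <-> v - w \in I.
Proof.
rewrite /quotmod_pi; have := @idealrBE V submod_pred v w.
by rewrite [v - w \in submod_pred]/(v - w \in I) => ->; split => /eqP.
Qed.

Lemma quotmod_piD v w : quotmod_pi (v + w) = quotmod_pi v + quotmod_pi w.
Proof. exact: pi_addr. Qed.

Lemma quotmod_ind (P : quotmod -> Prop) :
  (forall v, P (quotmod_pi v)) -> forall x, P x.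
Proof. by move=> H x; rewrite -[x]reprK; exact: H. Qed.

Definition quotmod_scale (a : K) (x : quotmod) : quotmod :=
  quotmod_pi (a *: repr x).

Lemma quotmod_piZ a v : quotmod_scale a (quotmod_pi v) = quotmod_pi (a *: v).
Proof.
apply/quotmod_piP; rewrite -scalerBr rpredZ//; apply/quotmod_piP.
exact: reprK.
Qed.

Lemma quotmod_scaleA a b x :
  quotmod_scale a (quotmod_scale b x) = quotmod_scale (a * b) x.
Proof. by elim/quotmod_ind: x => v; rewrite !quotmod_piZ scalerA. Qed.

Lemma quotmod_scale1 : left_id 1 quotmod_scale.
Proof. by elim/quotmod_ind => v; rewrite quotmod_piZ scale1r. Qed.

Lemma quotmod_scaleDr : right_distributive quotmod_scale +%R.
Proof.
move=> a; elim/quotmod_ind => v; elim/quotmod_ind => w.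
by rewrite -quotmod_piD !quotmod_piZ scalerDr quotmod_piD.
Qed.

Lemma quotmod_scaleDl x : {morph quotmod_scale^~ x : a b / a + b}.
Proof.
move=> a b; elim/quotmod_ind: x => v.
by rewrite !quotmod_piZ scalerDl quotmod_piD.
Qed.

HB.instance Definition _ := GRing.Zmodule_isLmodule.Build K quotmod
  quotmod_scaleA quotmod_scale1 quotmod_scaleDr quotmod_scaleDl.

Fact quotmod_pi_linear : linear quotmod_pi.
Proof. by move=> a v w; rewrite quotmod_piD -quotmod_piZ. Qed.

HB.instance Definition _ := GRing.isLinear.Build K V quotmod _ quotmod_pi
  quotmod_pi_linear.

End QuotientLmodule.

Section Smooth.
Variable R : realType.
Implicit Types f g : R -> R.

Definition smooth f : Prop := forall n x, derivable f^`(n) x 1.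

Lemma smooth_derivable f : smooth f -> forall x, derivable f x 1.
Proof. by move=> fs; exact: (fs 0%N). Qed.

Lemma smooth_derive1 f : smooth f -> smooth f^`().
Proof. by move=> fs n x; have := fs n.+1 x; rewrite derive1Sn. Qed.

Lemma smooth_derive1n f n : smooth f -> smooth f^`(n).
Proof.
by move=> fs; elim: n => [//|n IH]; rewrite derive1nS; exact: smooth_derive1.
Qed.

Lemma smooth_ind (K : (R -> R) -> Prop) :
  (forall f, K f -> (forall x, derivable f x 1) /\ K f^`()) ->
  forall f, K f -> smooth f.
Proof.
move=> KP f Kf n; suff : K f^`(n) by move=> /KP[].
by elim: n => [//|n /KP[_]]; rewrite derive1nS.
Qed.

Lemma derive1D f g : (forall x, derivable f x 1) -> (forall x, derivable g x 1) ->
  (f + g)^`() = f^`() + g^`().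
Proof.
by move=> df dg; apply/funext => x; rewrite derive1E deriveD// -!derive1E.
Qed.

Lemma derive1Z (a : R) f : (forall x, derivable f x 1) ->
  (a *: f)^`() = a *: f^`().
Proof.
by move=> df; apply/funext => x; rewrite derive1E deriveZ// -derive1E.
Qed.

Lemma derive1M f g : (forall x, derivable f x 1) -> (forall x, derivable g x 1) ->
  (f * g)^`() = f^`() * g + f * g^`().
Proof.
move=> df dg; apply/funext => x; rewrite derive1E deriveM// -!derive1E.
by rewrite addrC; congr (_ + _); exact: mulrC.
Qed.

Inductive prodsum : (R -> R) -> Prop :=
| prodsum_mul f g : smooth f -> smooth g -> prodsum (f * g)
| prodsum_add f g : prodsum f -> prodsum g -> prodsum (f + g)
| prodsum_scale a f : prodsum f -> prodsum (a *: f).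

Lemma prodsum_smooth f : prodsum f -> smooth f.
Proof.
apply: smooth_ind => {}f; elim=> {f}.
- move=> f g sf sg; have df := smooth_derivable sf.
  have dg := smooth_derivable sg; split; first by move=> x; exact: derivableM.
  rewrite derive1M//; apply: prodsum_add; apply: prodsum_mul => //;
    exact: smooth_derive1.
- move=> f g _ [df pf] _ [dg pg]; split; first by move=> x; exact: derivableD.
  by rewrite derive1D//; exact: prodsum_add.
- move=> a f _ [df pf]; split; first by move=> x; exact: derivableZ.
  by rewrite derive1Z//; exact: prodsum_scale.
Qed.

Lemma smooth_cst (c : R) : smooth (cst c).
Proof.
apply: (@smooth_ind (fun f => exists c, f = cst c)); last by exists c.
move=> _ [d ->]; split=> [x|]; first exact: derivable_cst.
by exists 0; apply/funext => x; rewrite derive1_cst.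
Qed.

Lemma prodsum_of_smooth f : smooth f -> prodsum f.
Proof.
move=> sf; have -> : f = f * cst 1 by apply/funext => x; exact/esym/mulr1.
by apply: prodsum_mul => //; exact: smooth_cst.
Qed.

Lemma smoothD f g : smooth f -> smooth g -> smooth (f + g).
Proof.
move=> sf sg; apply: prodsum_smooth.
by apply: prodsum_add; exact: prodsum_of_smooth.
Qed.

Lemma smoothZ a f : smooth f -> smooth (a *: f).
Proof.
move=> sf; apply: prodsum_smooth.
by apply: prodsum_scale; exact: prodsum_of_smooth.
Qed.

Lemma smoothM f g : smooth f -> smooth g -> smooth (f * g).
Proof. by move=> sf sg; apply: prodsum_smooth; exact: prodsum_mul. Qed.

Definition periodic f : Prop := forall x, f (x + 2 * pi) = f x.

Lemma periodic_derive1 f : periodic f -> periodic f^`().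
Proof.
move=> pf x; rewrite /derive1; under eq_fun do rewrite addrA !pf.
by [].
Qed.

(* Functions on the circle are identified with their [2 * pi]-periodic lifts. *)
Definition smooth_periodic : {pred R -> R} :=
  fun f => `[< smooth f /\ periodic f >].

Fact smooth_periodic_submod : submod_closed smooth_periodic.
Proof.
split.
  by apply/asboolP; split; [exact: (@smooth_cst 0)|move=> x].
move=> a f g /asboolP[sf pf] /asboolP[sg pg]; apply/asboolP; split.
  by apply: smoothD => //; exact: (@smoothZ a).
move=> x; rewrite [LHS]/(a * f (x + 2 * pi) + g (x + 2 * pi)).
by rewrite pf pg.
Qed.

HB.instance Definition _ := GRing.isSubmodClosed.Build R (R -> R)
  smooth_periodic smooth_periodic_submod.

End Smooth.

Record vectS1 (R : realType) := VectS1 {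
  vectS1_fun :> R -> R ;
  vectS1P : vectS1_fun \in @smooth_periodic R }.

HB.instance Definition _ (R : realType) := [isSub for @vectS1_fun R].
HB.instance Definition _ (R : realType) := [Choice of vectS1 R by <:].
HB.instance Definition _ (R : realType) :=
  [SubChoice_isSubLmodule of vectS1 R by <:].

Section Bracket.
Variable R : realType.
Implicit Types u v : vectS1 R.

Fact bracket_subproof u v :
  (fun x => u x * v^`() x - u^`() x * v x) \in @smooth_periodic R.
Proof.
have /asboolP[su pu] := vectS1P u; have /asboolP[sv pv] := vectS1P v.
have -> : (fun x => u x * v^`() x - u^`() x * v x) =
    (u : R -> R) * v^`() + (-1 : R) *: (u^`() * (v : R -> R)).
  by apply/funext => x; rewrite -[in LHS]mulN1r.
apply/asboolP; split.
  apply: smoothD; first by apply: smoothM => //; exact: smooth_derive1.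
  by apply: smoothZ; apply: smoothM => //; exact: smooth_derive1.
move=> x; have du := periodic_derive1 pu; have dv := periodic_derive1 pv.
rewrite [LHS]/(u _ * v^`() _ + -1 * (u^`() _ * v _)).
by rewrite pu pv du dv.
Qed.

Definition bracket u v : vectS1 R := VectS1 (bracket_subproof u v).

End Bracket.

Section Cochains.
Variable R : realType.

Local Notation mu := (@lebesgue_measure R).
Local Notation V := (vectS1 R).

(* All functions of [p] vector fields; the cochains of the complex are those
   satisfying [local_cochain] below. *)
Definition map_cochain (p : nat) : Type := ('I_p -> V) -> R.

HB.instance Definition _ p := GRing.Lmodule.copy (map_cochain p)
  (('I_p -> V) -> R).

Section FixedDegree.
Variable p : nat.
Implicit Types (g : map_cochain p) (u : 'I_p -> V).

Definition multilinear g : Prop := forall u (i : 'I_p) (a : R) (v w : V),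
  g (dfwith u i (a *: v + w)) = a * g (dfwith u i v) + g (dfwith u i w).

Definition alternating g : Prop := forall u (i j : 'I_p),
  i != j -> u i = u j -> g u = 0.

(* A [p]-linear differential operator is a finite sum of terms
   [a * u_0^(k_0) * ... * u_(p-1)^(k_(p-1))] with [a] smooth and periodic; the
   list [s] enumerates the pairs [(a, k)]. *)
Definition diff_op (s : seq (V * ('I_p -> nat))) u (x : R) : R :=
  \sum_(t <- s) t.1 x * \prod_(i < p) (u i)^`(t.2 i) x.

Definition is_local g : Prop := exists s : seq (V * ('I_p -> nat)),
  forall u, g u = \int[mu]_(x in `[0, 2 * pi]) diff_op s u x.

Definition local_cochain g : Prop :=
  [/\ multilinear g, alternating g & is_local g].

End FixedDegree.

(* The arguments of the [(i, j)] term are [[u_i, u_j]] followed by the [u_l]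
   for [l] different from [i] and [j], in increasing order. *)
Definition coboundary p (g : map_cochain p) : map_cochain p.+1 := fun u =>
  \sum_(i < p.+1) \sum_(j < p.+1 | (i < j)%N) (-1) ^+ (i + j) *
    g (fun k : 'I_p => nth 0 (bracket (u i) (u j) ::
          [seq u l | l <- enum 'I_p.+1 & l \notin [:: i; j]]) k).

Lemma sum_linear (I : Type) (r : seq I) (P : pred I) (a : R) (F G : I -> R) :
  \sum_(i <- r | P i) (a * F i + G i) =
  a * \sum_(i <- r | P i) F i + \sum_(i <- r | P i) G i.
Proof. by rewrite big_split/= mulr_sumr. Qed.

Lemma coboundary_linear p a (g h : map_cochain p) :
  coboundary (a *: g + h) = a *: coboundary g + coboundary h.
Proof.
apply/funext => u; rewrite [RHS]/(a * coboundary g u + coboundary h u).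
etransitivity; last exact: sum_linear.
apply: eq_bigr => i _; etransitivity; last exact: sum_linear.
by apply: eq_bigr => j _; rewrite mulrCA -mulrDr.
Qed.

Lemma coboundary0 p : coboundary (0 : map_cochain p) = 0.
Proof.
apply/funext => u; rewrite /coboundary big1// => i _.
by rewrite big1// => j _; exact: mulr0.
Qed.

Lemma continuous_integrable_circle (f : R -> R) : continuous f ->
  mu.-integrable `[0, 2 * pi] (EFin \o f).
Proof.
move=> cf; apply: continuous_compact_integrable; first exact: segment_compact.
exact: continuous_subspaceT.
Qed.

Lemma diff_op_continuous p (s : seq (V * ('I_p -> nat))) u :
  continuous (diff_op s u).
Proof.
suff sm : smooth (diff_op s u).
  move=> x; apply: differentiable_continuous.
  by apply/derivable1_diffP; exact: smooth_derivable.
have smV (v : V) : smooth v by have /asboolP[] := vectS1P v.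
have -> : diff_op s u =
    \sum_(t <- s) (t.1 : R -> R) * \prod_(i < p) (u i)^`(t.2 i).
  apply/funext => x; rewrite fct_sumE; apply: eq_bigr => t _.
  by rewrite fct_prodE.
elim/big_ind: _ => [||t _]; [exact: (@smooth_cst R 0)|exact: smoothD|].
apply: smoothM => //.
elim/big_ind: _ => [||i _]; [exact: (@smooth_cst R 1)|exact: smoothM|].
exact: smooth_derive1n.
Qed.

Lemma local_cochain_submod p a (g h : map_cochain p) :
  local_cochain g -> local_cochain h -> local_cochain (a *: g + h).
Proof.
move=> [mg ag [s sg]] [mh ah [t th]].
have E u : (a *: g + h) u = a * g u + h u by [].
split.
- by move=> u i b v w; rewrite !E mg mh !mulrDr !mulrA [a * b]mulrC addrACA.
- by move=> u i j ij uij; rewrite E (ag _ _ _ ij uij) (ah _ _ _ ij uij) mulr0 addr0.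
exists ([seq (a *: k.1, k.2) | k <- s] ++ t) => u.
have int (r : seq (V * ('I_p -> nat))) :=
  continuous_integrable_circle (@diff_op_continuous p r u).
rewrite E sg th -RintegralZl// -RintegralD//; last first.
  exact: (integrableZl _ a (int s)).
apply: eq_Rintegral => x _; rewrite /diff_op big_cat big_map /= mulr_sumr.
by congr (_ + _); apply: eq_bigr => k _; rewrite mulrA.
Qed.

Lemma local_cochain0 p : local_cochain (0 : map_cochain p).
Proof.
split=> [u i a v w|//|].
  have : (0 : R) = a * 0 + 0 by rewrite mulr0 addr0.
  exact.
exists [::] => u; under eq_Rintegral do rewrite /diff_op big_nil.
by rewrite /Rintegral integral0.
Qed.

Definition is_cocycle p : {pred map_cochain p} :=
  fun g => `[< local_cochain g /\ coboundary g = 0 >].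

Fact is_cocycle_submod p : submod_closed (@is_cocycle p).
Proof.
split; first by apply/asboolP; split; [exact: local_cochain0|exact: coboundary0].
move=> a g h /asboolP[lg cg] /asboolP[lh ch]; apply/asboolP; split.
  exact: local_cochain_submod.
by rewrite coboundary_linear cg ch scaler0 addr0.
Qed.

HB.instance Definition _ p := GRing.isSubmodClosed.Build R (map_cochain p)
  (@is_cocycle p) (@is_cocycle_submod p).

Record cocycle p := Cocycle {
  cocycle_val :> map_cochain p ;
  cocycleP : cocycle_val \in @is_cocycle p }.

HB.instance Definition _ p := [isSub for @cocycle_val p].
HB.instance Definition _ p := [Choice of cocycle p by <:].
HB.instance Definition _ p := [SubChoice_isSubLmodule of cocycle p by <:].

(* There is no cochain of degree [-1]. *)
Definition coboundary_of p : map_cochain p -> Prop :=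
  match p with
  | 0 => fun g => g = 0
  | q.+1 => fun g => exists2 m : map_cochain q, local_cochain m & g = coboundary m
  end.

(* Coboundaries are taken inside the space of cocycles, so that no proof that the
   coboundary operator squares to zero is needed to form the quotient. *)
Definition is_coboundary p : {pred cocycle p} :=
  fun z => `[< coboundary_of (cocycle_val z) >].

Fact is_coboundary_submod p : submod_closed (@is_coboundary p).
Proof.
split; first apply/asboolP.
  case: p => [//|p] /=.
  by exists 0; [exact: local_cochain0|rewrite coboundary0].
move=> a y z /asboolP cy /asboolP cz; apply/asboolP.
have -> : cocycle_val (a *: y + z) = a *: cocycle_val y + cocycle_val z by [].
case: p y z cy cz => [|p] y z /=; first by move=> -> ->; rewrite scaler0 addr0.
move=> [m lm ->] [n ln ->]; exists (a *: m + n).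
  exact: local_cochain_submod.
by rewrite coboundary_linear.
Qed.

HB.instance Definition _ p := GRing.isSubmodClosed.Build R (cocycle p)
  (@is_coboundary p) (@is_coboundary_submod p).

Definition H_GF p : lmodType R := quotmod (@is_coboundary p).

Definition cohomology_class p (z : cocycle p) : H_GF p :=
  quotmod_pi (@is_coboundary p) z.

Definition vir : map_cochain 2 := fun u =>
  let v := u ord_max in let u := u ord0 in
  \int[mu]_(x in `[0, 2 * pi]) (u^`() x * v^`(2) x - v^`() x * u^`(2) x).

End Cochains.

Arguments vir : clear implicits.

(* Main.v *)
Require Import Defs.
From HB Require Import structures.
From mathcomp Require Import all_boot all_order all_algebra.
From mathcomp Require Import all_classical all_reals all_analysis.
From mathcomp Require Import ring lra.

(* Integrating by parts, a local 2-cochain is g(u, v) = \int u L(v) for a linear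
   differential operator L = \sum_j c_j D^j, skew-adjoint because g alternates.
   Since \int u f = 0 for all u forces f = 0, the cocycle condition becomes
     L [v, w] = 2 v' L w + v (L w)' - 2 w' L v - w (L v)'.
   For v = 1 this gives c_1' = 2 c_0 and c_j' = 0 for j >= 2; for v with the
   jet of y - x at a point x it gives (j - 3) c_j(x) = 0 for j >= 2. Hence
   L v = c_1'/2 v + c_1 v' + a v''', where a is a constant: the first two terms
   are the coboundary of w |-> - 1/2 \int c_1 w and the last one is - a/2 times
   vir. Conversely the operator of a coboundary has order at most 1, so vir is
   not a coboundary. *)

Set Implicit Arguments.
Unset Strict Implicit.
Unset Printing Implicit Defensive.

Import Order.TTheory GRing.Theory Num.Theory.
Import numFieldNormedType.Exports.

Local Open Scope classical_set_scope.
Local Open Scope ring_scope.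

Local Notation "f ^` ()" := (derive1 f) : ring_scope.
Local Notation "f ^` ( n )" := (derive1n n f) : ring_scope.

(** * The algebra of periodic functions, its derivation and its integral *)

Section CircleAlgebra.
Variable R : realType.
Implicit Types u v w : vectS1 R.

Lemma vectS1_smooth u : smooth u.
Proof. by have /asboolP[] := vectS1P u. Qed.

Lemma vectS1_periodic u : Defs.periodic u.
Proof. by have /asboolP[] := vectS1P u. Qed.

Lemma vectS1_eq u v : (forall x, u x = v x) -> u = v.
Proof. by move=> uv; apply: val_inj; apply/funext. Qed.

Lemma vectS1D u v x : (u + v) x = u x + v x. Proof. by []. Qed.
Lemma vectS1Z a u x : (a *: u) x = a * u x. Proof. by []. Qed.
Lemma vectS1_0 x : (0 : vectS1 R) x = 0. Proof. by []. Qed.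

Lemma vectS1_sum (T : Type) (r : seq T) (F : T -> vectS1 R) x :
  (\sum_(t <- r) F t) x = \sum_(t <- r) F t x.
Proof.
pose ev (w : vectS1 R) := w x.
exact: (big_morph ev (id1 := 0) (op1 := +%R)).
Qed.

Fact vectS1_mul_subproof u v :
  (u : R -> R) * (v : R -> R) \in @smooth_periodic R.
Proof.
apply/asboolP; split; first by apply: smoothM; exact: vectS1_smooth.
move=> x; rewrite [LHS]/(u _ * v _).
by rewrite !vectS1_periodic.
Qed.

Fact vectS1_cst_subproof (a : R) : cst a \in @smooth_periodic R.
Proof. by apply/asboolP; split; [exact: smooth_cst|]. Qed.

(** The pointwise product makes vector fields a commutative algebra, so that [ring] settles
    identities between integrands. *)
Definition vectS1_mul u v : vectS1 R := VectS1 (vectS1_mul_subproof u v).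
Definition vectS1_cst (a : R) : vectS1 R := VectS1 (vectS1_cst_subproof a).

Fact vectS1_mulA : associative vectS1_mul.
Proof. by move=> u v w; apply: vectS1_eq => x; exact: mulrA. Qed.

Fact vectS1_mulC : commutative vectS1_mul.
Proof. by move=> u v; apply: vectS1_eq => x; exact: mulrC. Qed.

Fact vectS1_mul1 : left_id (vectS1_cst 1) vectS1_mul.
Proof. by move=> u; apply: vectS1_eq => x; exact: mul1r. Qed.

Fact vectS1_mulDl : left_distributive vectS1_mul +%R.
Proof. by move=> u v w; apply: vectS1_eq => x; exact: mulrDl. Qed.

Fact vectS1_one_neq0 : vectS1_cst 1 != 0.
Proof.
apply/eqP => /(congr1 (fun u : vectS1 R => u 0)) h.
by have /eqP := h : (1 : R) = 0; rewrite oner_eq0.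
Qed.

HB.instance Definition _ := GRing.Zmodule_isComNzRing.Build (vectS1 R)
  vectS1_mulA vectS1_mulC vectS1_mul1 vectS1_mulDl vectS1_one_neq0.

Fact vectS1_scalerAl (a : R) u v : a *: (u * v) = (a *: u) * v.
Proof. by apply: vectS1_eq => x; exact: mulrA. Qed.

HB.instance Definition _ :=
  GRing.Lmodule_isLalgebra.Build R (vectS1 R) vectS1_scalerAl.

HB.instance Definition _ :=
  GRing.Lalgebra_isComAlgebra.Build R (vectS1 R).

Lemma vectS1M u v x : (u * v) x = u x * v x. Proof. by []. Qed.
Lemma vectS1_1 x : (1 : vectS1 R) x = 1. Proof. by []. Qed.

Fact vectS1_derive_subproof u : u^`() \in @smooth_periodic R.
Proof.
apply/asboolP; split; first by apply: smooth_derive1; exact: vectS1_smooth.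
by apply: periodic_derive1; exact: vectS1_periodic.
Qed.

Definition vectS1_derive u : vectS1 R := VectS1 (vectS1_derive_subproof u).
Local Notation D := vectS1_derive.
Local Notation Dn n := (iter n D).

Lemma derivable_vectS1 u x : derivable u x 1.
Proof. exact/smooth_derivable/vectS1_smooth. Qed.

Lemma continuous_vectS1 u : continuous u.
Proof.
move=> x; apply: differentiable_continuous.
by apply/derivable1_diffP; exact: derivable_vectS1.
Qed.

Lemma iter_vectS1_derive n u : Dn n u = u^`(n) :> (R -> R).
Proof. by elim: n => // n IH; rewrite derive1nS -IH. Qed.

Fact vectS1_derive_linear : linear D.
Proof.
move=> a u v; apply: val_inj; rewrite /= (derive1D (f := a *: (u : R -> R))).
- by rewrite derive1Z//; exact: derivable_vectS1.
- by move=> x; apply: derivableZ; exact: derivable_vectS1.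
- exact: derivable_vectS1.
Qed.

HB.instance Definition _ := GRing.isLinear.Build R (vectS1 R) (vectS1 R)
  _ D vectS1_derive_linear.

Lemma vectS1_deriveD u v : D (u + v) = D u + D v. Proof. exact: linearD. Qed.
Lemma vectS1_deriveN u : D (- u) = - D u. Proof. exact: linearN. Qed.
Lemma vectS1_deriveMn u n : D (u *+ n) = D u *+ n. Proof. exact: linearMn. Qed.

Lemma vectS1_deriveM u v : D (u * v) = D u * v + u * D v.
Proof.
by apply: val_inj; rewrite /= derive1M//; exact: derivable_vectS1.
Qed.

Lemma vectS1_derive1 : D 1 = 0.
Proof. by apply: vectS1_eq => x; rewrite /= derive1_cst. Qed.

Lemma vectS1_derive_eq0 u : D u = 0 -> u = (u 0)%:A.
Proof.
move=> Du; apply: vectS1_eq => x.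
rewrite vectS1Z vectS1_1 mulr1; apply: is_derive_0_is_cst => y.
have := derivableP (@derivable_vectS1 u y); rewrite -derive1E.
by rewrite -[u^`() y]/(D u y) Du.
Qed.

Lemma bracketE u v : bracket u v = u * D v - D u * v.
Proof. exact: vectS1_eq. Qed.

Definition circle_int u : R :=
  \int[@lebesgue_measure R]_(x in `[0, 2 * pi]) u x.
Local Notation I := circle_int.

Fact circle_int_linear : scalar I.
Proof.
move=> a u v.
have int w := continuous_integrable_circle (@continuous_vectS1 w).
rewrite /I -RintegralZl ?int//.
rewrite -RintegralD ?int//; exact: (int (a *: u)).
Qed.

HB.instance Definition _ := GRing.isLinear.Build R (vectS1 R) R
  *%R I circle_int_linear.

Lemma circle_intD u v : I (u + v) = I u + I v. Proof. exact: linearD. Qed.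
Lemma circle_intN u : I (- u) = - I u. Proof. exact: linearN. Qed.
Lemma circle_intZ a u : I (a *: u) = a * I u. Proof. exact: linearZ. Qed.

Lemma twopi_gt0 : 0 < 2 * pi :> R.
Proof. by rewrite mulr_gt0// pi_gt0. Qed.

(** The fundamental theorem of calculus leaves u(2 pi) - u(0), which periodicity cancels. *)
Lemma circle_int_derive u : I (D u) = 0.
Proof.
rewrite /I /Rintegral (@continuous_FTC2 R (D u) u 0 (2 * pi)) ?twopi_gt0//.
- by have := vectS1_periodic u 0; rewrite add0r => ->; rewrite -EFinB subrr.
- by apply: continuous_subspaceT; exact: continuous_vectS1.
split=> [x _||]; first exact: derivable_vectS1.
- by apply: cvg_at_right_filter; exact: continuous_vectS1.
- by apply: cvg_at_left_filter; exact: continuous_vectS1.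
Qed.

Lemma circle_int_by_parts u v : I (D u * v) = - I (u * D v).
Proof.
by apply/eqP; rewrite -addr_eq0 -circle_intD -vectS1_deriveM circle_int_derive.
Qed.

Lemma vectS1_shift u x (k : int) : u (x + 2 * pi *~ k) = u x.
Proof.
have P y n : u (y + 2 * pi *+ n) = u y.
  elim: n => [|n IH]; first by rewrite addr0.
  by rewrite mulrSr addrA vectS1_periodic.
case: k => n; first exact: P.
by rewrite NegzE mulrNz -[LHS](P _ n.+1) subrK.
Qed.

(** Right continuity gives the value at 0, and a shift by a multiple of the period brings any other
    point into the interval. *)
Lemma vectS1_eq0 u : (forall x, 0 < x < 2 * pi -> u x = 0) -> u = 0.
Proof.
move=> u0; have u00 : u 0 = 0.
  apply: contrapT => /eqP n0.
  have : \forall x \near (0 : R)^'+, u x != 0.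
    apply: cvgr_neq0 n0; apply: cvg_at_right_filter.
    exact: continuous_vectS1.
  move=> H; near (0 : R)^'+ => x.
  have /eqP : u x != 0 by near: x.
  apply; apply: u0; apply/andP; split; near: x; first exact: nbhs_right_gt.
  exact/nbhs_right_lt/twopi_gt0.
apply: vectS1_eq => x; pose k := Num.floor (x / (2 * pi)).
have pi2 := twopi_gt0.
have -> : x = (x - 2 * pi *~ k) + 2 * pi *~ k by rewrite subrK.
rewrite vectS1_shift -mulrzr.
have : 0 <= x - 2 * pi * k%:~R < 2 * pi.
  have /andP[] := floor_itv (x / (2 * pi)).
  rewrite ler_pdivlMr// ltr_pdivrMr// -/k intrD1.
  rewrite [(_%:~R + 1) * _]mulrDl mul1r mulrC => kx xk.
  by rewrite subr_ge0 kx ltrBlDl.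
move=> /andP[]; rewrite le_eqVlt => /orP[/eqP <- //|h1 h2].
by apply: u0; rewrite h1.
Unshelve. all: by end_near.
Qed.

(** A nonnegative function with integral zero vanishes almost everywhere. If [u] were nonzero at an
    interior point, continuity would make a ball of positive measure negligible. *)
Lemma circle_int_sqr_eq0 u : I (u * u) = 0 -> u = 0.
Proof.
move=> I0; pose mu := @lebesgue_measure R.
have int := continuous_integrable_circle (@continuous_vectS1 (u * u)).
pose A := [set` `[0 : R, 2 * pi]].
have mD : measurable A by exact: measurable_itv.
have /ae_eq_integral_abs ae0 :
    (\int[mu]_(x in A) `|((u * u) x)%:E| = 0)%E.
  transitivity (\int[mu]_(x in A) ((u * u) x)%:E)%E.
    apply: eq_integral => x _; rewrite gee0_abs// lee_fin.
    exact: sqr_ge0.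
  by rewrite -[LHS]fineK ?integrable_fin_num// -[fine _]/(I (u * u)) I0.
have ae := ae0 mD (measurable_int _ int).
apply: vectS1_eq0 => x /andP[x0 xpi].
apply: contrapT => /eqP nx.
have : \forall y \near x, [/\ 0 < y, y < 2 * pi & u y != 0].
  near=> y; split; near: y.
  - exact: lt_nbhsr.
  - exact: lt_nbhsl.
  - by apply: cvgr_neq0 nx; exact: continuous_vectS1.
move=> /nbhs_ballP[e/= e0 He].
have : mu.-negligible (ball x e).
  apply: negligibleS ae => y /He[y0 y1 uy] /=.
  move=> uyA; have : A y by rewrite /A/= in_itv/= (ltW y0) (ltW y1).
  move=> /uyA yy; have /eqP : u y * u y = 0 by case: yy.
  by rewrite mulf_eq0 orbb (negbTE uy).
move=> /negligibleP.
have mB : measurable (ball x e) by rewrite ball_itv; exact: measurable_itv.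
move=> /(_ mB) mB0.
have := etrans (esym (lebesgue_measure_ball x (ltW e0))) mB0.
by move=> /eqP; rewrite eqe mulrn_eq0/= gt_eqF.
Unshelve. all: by end_near.
Qed.

End CircleAlgebra.

Arguments vectS1_derive : simpl never.

(** * Jets of periodic functions at a point *)

Section Jets.
Variables (R : realType) (x : R).
Implicit Types u v w f g h s : vectS1 R.
Local Notation D := (@vectS1_derive R).
Local Notation Dn n := (iter n (@vectS1_derive R)).

Lemma iter_deriveD n u v : Dn n (u + v) = Dn n u + Dn n v.
Proof. by elim: n u v => //= n IH u v; rewrite IH linearD. Qed.

Lemma iter_deriveZ n (a : R) u : Dn n (a *: u) = a *: Dn n u.
Proof. by elim: n => //= n ->; rewrite linearZ. Qed.

Lemma iter_deriveSM n u v : Dn n.+1 (u * v) = Dn n (D u * v) + Dn n (u * D v).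
Proof. by rewrite iterSr vectS1_deriveM iter_deriveD. Qed.

Fact vectS1_sin_subproof : (fun y => sin (y - x)) \in @smooth_periodic R.
Proof.
apply/asboolP; split; last first.
  by move=> y; rewrite addrAC [2 * pi]mulr_natl sinD2pi.
(* Combinations of the shifted sine and cosine are closed under differentiation, as [smooth_ind]
   requires. *)
pose K (f : R -> R) := exists a b : R,
  f = fun y => a * sin (y - x) + b * cos (y - x).
have Ksin : K (fun y => sin (y - x)).
  by exists 1, 0; apply/funext => y; rewrite mul1r mul0r addr0.
apply: (smooth_ind _ Ksin) => _ [a [b ->]].
have H y : is_derive y (1 : R) (fun y => a * sin (y - x) + b * cos (y - x))
    (- b * sin (y - x) + a * cos (y - x)).
  apply: is_derive_eq; rewrite /GRing.scale/=; ring.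
split=> [y|]; first exact: ex_derive.
exists (- b), a; apply/funext => y; rewrite derive1E; exact: derive_val.
Qed.

(** A periodic substitute for the coordinate y - x: it has a simple zero with slope 1 at [x]. *)
Definition vectS1_sin : vectS1 R := VectS1 vectS1_sin_subproof.

Lemma vectS1_sin0 : vectS1_sin x = 0.
Proof. by rewrite /= subrr sin0. Qed.

Lemma vectS1_derive_sin : D vectS1_sin x = 1.
Proof.
rewrite [LHS]derive1E; have H : is_derive x (1 : R) (fun y => sin (y - x)) 1.
  by apply: is_derive_eq; rewrite subrr cos0 /GRing.scale/=; ring.
exact: derive_val.
Qed.

(** In the Leibniz formula every other term contains a derivative of [f] of order below [n]. *)
Lemma iter_deriveM_flat n f h : (forall i, (i < n)%N -> Dn i f x = 0) ->
  Dn n (h * f) x = h x * Dn n f x.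
Proof.
elim: n f h => [//|n IH] f h f0.
rewrite iter_deriveSM vectS1D IH; last by move=> i /ltnW/f0.
rewrite f0// mulr0 add0r IH -?iterSr// => i iN.
by rewrite -iterSr f0.
Qed.

Lemma iter_deriveM_const n f h : (forall i, (0 < i <= n)%N -> Dn i h x = 0) ->
  Dn n (h * f) x = h x * Dn n f x.
Proof.
elim: n f h => [//|n IH] f h h0; rewrite iter_deriveSM vectS1D [D h * f]mulrC.
rewrite (iter_deriveM_flat (f := D h)) => [|i ilt]; last first.
  by rewrite -iterSr h0//= leqW.
rewrite -iterSr h0 ?leqnn// mulr0 add0r IH -?iterSr// => i /andP[i0 ile].
by rewrite h0// i0 leqW.
Qed.

(** Of the Leibniz formula only the terms with [h] and its first derivative remain, and the former
    vanishes at [x]; the factor is the binomial coefficient. *)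
Lemma iter_deriveM_linear n f h : h x = 0 ->
  (forall i, (1 < i <= n.+1)%N -> Dn i h x = 0) ->
  Dn n.+1 (h * f) x = D h x * Dn n f x *+ n.+1.
Proof.
move=> hx; elim: n f => [|n IH] f h0.
  by rewrite [Dn 1 _]vectS1_deriveM vectS1D !vectS1M hx mul0r addr0.
rewrite iter_deriveSM vectS1D iter_deriveM_const; last first.
  by move=> i /andP[i0 ile]; rewrite -iterSr h0// ltnS i0.
rewrite IH -?iterSr ?mulrS// => i /andP[i0 ile].
by rewrite h0// i0 leqW.
Qed.

Lemma iter_deriveM_flat_linear n f h : h x = 0 ->
  (forall i, (i < n)%N -> Dn i f x = 0) ->
  Dn n.+1 (h * f) x = D h x * Dn n f x *+ n.+1.
Proof.
move=> hx; elim: n f => [|n IH] f f0.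
  by rewrite [Dn 1 _]vectS1_deriveM vectS1D !vectS1M hx mul0r addr0.
rewrite iter_deriveSM vectS1D iter_deriveM_flat//.
by rewrite IH -?iterSr ?mulrS// => i ilt; rewrite -iterSr f0.
Qed.

(** Each further factor has a simple zero of slope 1, so it raises the order of vanishing by one and
    multiplies the leading derivative by [n.+1]. *)
Lemma iter_derive_sinX n :
  (forall i, (i < n)%N -> Dn i (vectS1_sin ^+ n) x = 0) /\
  Dn n (vectS1_sin ^+ n) x = n`!%:R.
Proof.
elim: n => [|n [IH1 IH2]]; first by split=> // i; rewrite ltn0.
rewrite exprS; split=> [i|]; last first.
  rewrite iter_deriveM_flat_linear ?vectS1_sin0//.
  by rewrite vectS1_derive_sin mul1r IH2 factS natrM mulr_natl.
rewrite ltnS => ile; rewrite iter_deriveM_flat ?vectS1_sin0 ?mul0r// => j jlt.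
by rewrite IH1// (leq_trans jlt).
Qed.

(* Powers of [sin (y - x)] have triangular jets at [x]. *)
Lemma exists_jet n (t : nat -> R) :
  exists v : vectS1 R, forall j, (j < n)%N -> Dn j v x = t j.
Proof.
elim: n => [|n [v vt]]; first by exists 0.
have [s0 sn] := iter_derive_sinX n.
exists (v + ((t n - Dn n v x) / n`!%:R) *: vectS1_sin ^+ n) => j.
rewrite iter_deriveD iter_deriveZ vectS1D vectS1Z ltnS leq_eqVlt.
move=> /orP[/eqP->|jn]; last by rewrite s0// mulr0 addr0 vt.
by rewrite sn divfK ?pnatr_eq0 -?lt0n ?fact_gt0// addrC subrK.
Qed.

End Jets.

(** * Linear differential operators and integration by parts *)

Section DiffOp.
Variable R : realType.
Implicit Types (u v w : vectS1 R) (c : nat -> vectS1 R).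
Implicit Types s : seq (vectS1 R * nat).
Local Notation D := (@vectS1_derive R).
Local Notation Dn n := (iter n (@vectS1_derive R)).
Local Notation I := (@circle_int R).

Definition diffop n c v : vectS1 R := \sum_(j < n) c j * Dn j v.
(** Lists may repeat an order, which suits integration by parts; [diffop] has one coefficient per
    order, which jets can detect. *)
Definition diffop_seq s v : vectS1 R := \sum_(t <- s) t.1 * Dn t.2 v.

(* The order is padded so that [c 0], ..., [c 3] always occur. *)
Lemma diffop_seqE s :
  exists n c, forall v, diffop_seq s v = diffop n.+4 c v.
Proof.
exists (\max_(t <- s) t.2)%N, (fun j => \sum_(t <- s | t.2 == j) t.1) => v.
rewrite /diffop_seq /diffop.
under [RHS]eq_bigr do rewrite mulr_suml big_mkcond.
rewrite exchange_big; apply: eq_big_seq => t ts /=.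
have tmax : (t.2 <= \max_(t <- s) t.2)%N by exact: leq_bigmax_seq.
rewrite (bigD1 (inord t.2)) //= inordK ?ltnS ?(leq_trans tmax) ?leqW//.
rewrite eqxx big1 ?addr0// => i /eqP ni.
by case: eqP => // ti; case: ni; rewrite ti inord_val.
Qed.

Lemma diffopD n c u v : diffop n c (u + v) = diffop n c u + diffop n c v.
Proof.
by rewrite -big_split; apply: eq_bigr => j _; rewrite iter_deriveD mulrDr.
Qed.

Lemma diffop_jet n c v x :
  diffop n c v x = \sum_(j < n) c j x * Dn j v x.
Proof. exact: vectS1_sum. Qed.

Lemma diffop_seq_derive s :
  exists s', forall v, D (diffop_seq s v) = diffop_seq s' v.
Proof.
exists ([seq (D t.1, t.2) | t <- s] ++ [seq (t.1, t.2.+1) | t <- s]) => v.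
rewrite /diffop_seq big_cat !big_map /= -big_split.
apply: etrans (linear_sum D _ _ _) _.
by apply: eq_bigr => t _; rewrite /= vectS1_deriveM.
Qed.

(** Each integration by parts moves one derivative from [u] onto the operator and puts the sign into
    its coefficients. *)
Lemma diffop_seq_by_parts k s :
  exists s', forall u v, I (Dn k u * diffop_seq s v) = I (u * diffop_seq s' v).
Proof.
elim: k s => [|k IH] s; first by exists s.
have [s1 Ds] := diffop_seq_derive s.
have [s2 s2E] := IH [seq (- t.1, t.2) | t <- s1].
exists s2 => u v; rewrite -s2E /= circle_int_by_parts Ds -circle_intN -mulrN.
congr (I (_ * _)); rewrite /diffop_seq big_map -sumrN.
by apply: eq_bigr => t _; rewrite mulNr.
Qed.

Lemma local_diffop_by_parts (s : seq (vectS1 R * (nat * nat))) :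
  exists n c, forall u v,
  I (\sum_(t <- s) t.1 * (Dn t.2.1 u * Dn t.2.2 v)) = I (u * diffop n.+4 c v).
Proof.
suff [s' s'E] : exists s', forall u v,
    I (\sum_(t <- s) t.1 * (Dn t.2.1 u * Dn t.2.2 v)) = I (u * diffop_seq s' v).
  by have [n [c E]] := diffop_seqE s'; exists n, c => u v; rewrite s'E E.
elim: s => [|[a [k l]] s [s1 s1E]].
  by exists [::] => u v; rewrite /diffop_seq !big_nil mulr0.
have [s2 s2E] := diffop_seq_by_parts k [:: (a, l)].
exists (s2 ++ s1) => u v.
rewrite /diffop_seq big_cat /= mulrDr circle_intD -s1E -s2E.
rewrite big_cons circle_intD.
by rewrite /diffop_seq big_seq1 /= mulrCA.
Qed.

End DiffOp.

(** * Local cochains of degree one and two as integrals *)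

Section LowDegree.
Variable R : realType.
Implicit Types (u v w b : vectS1 R) (m : map_cochain R 1) (g : map_cochain R 2).
Local Notation D := (@vectS1_derive R).
Local Notation Dn n := (iter n (@vectS1_derive R)).
Local Notation I := (@circle_int R).

Definition vec1 u : 'I_1 -> vectS1 R := fun=> u.
(** Written with [nth] as in [coboundary], whose arguments then take this shape once the list is
    computed. *)
Definition vec2 u v : 'I_2 -> vectS1 R := fun k => nth 0 [:: u; v] k.

Lemma vec1_eta (f : 'I_1 -> vectS1 R) : f = vec1 (f ord0).
Proof. by apply/funext => k; rewrite ord1. Qed.

Lemma vec2_eta (f : 'I_2 -> vectS1 R) : f = vec2 (f ord0) (f ord_max).
Proof.
apply/funext => -[[|[|//]] k] /=; rewrite /vec2 /=; congr f; exact: val_inj.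
Qed.

(** Integrate the term with u' by parts. Vector fields pair with quadratic differentials, and the
    factor of [u] on the right is the Lie derivative of [w] along [v]. *)
Lemma circle_int_adjoint_bracket u v w :
  I (bracket u v * w) = I (u * (D v * w *+ 2 + v * D w)).
Proof.
rewrite bracketE mulrBl circle_intD circle_intN -[D u * v * w]mulrA.
rewrite circle_int_by_parts opprK -circle_intD vectS1_deriveM.
by congr I; ring.
Qed.

Lemma circle_int_eq0 u : (forall v, I (v * u) = 0) -> u = 0.
Proof. by move=> u0; apply: circle_int_sqr_eq0. Qed.

Lemma coboundary1E m u v : coboundary m (vec2 u v) = - m (vec1 (bracket u v)).
Proof.
rewrite /coboundary; under eq_bigr do rewrite big_mkcond /=.
rewrite !big_ord_recl !big_ord0 /= !addr0 add0r /bump /= expr1 mulN1r.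
by congr (- m _); rewrite [LHS]vec1_eta.
Qed.

Lemma enum_ord3 :
  enum 'I_3 = [:: ord0; lift ord0 ord0; lift ord0 (lift ord0 ord0)].
Proof. by apply: (inj_map val_inj); rewrite val_enum_ord. Qed.

(** The index pairs (0,1), (0,2), (1,2) carry the signs -, +, -; the middle bracket is [u, w], not
    the cyclic [w, u]. *)
Lemma coboundary2E g (f : 'I_3 -> vectS1 R) :
  let u := f ord0 in let v := f (lift ord0 ord0) in
  let w := f (lift ord0 (lift ord0 ord0)) in
  coboundary g f = - g (vec2 (bracket u v) w) + g (vec2 (bracket u w) v) -
    g (vec2 (bracket v w) u).
Proof.
rewrite /coboundary enum_ord3; under eq_bigr do rewrite big_mkcond /=.
rewrite !big_ord_recl !big_ord0 /= !addr0 !add0r.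
rewrite /bump /= /vec2; congr (_ + _ + _).
- by rewrite expr1 mulN1r.
- by rewrite -signr_odd mul1r.
- by rewrite -signr_odd mulN1r.
Qed.

Lemma local1P m : is_local m -> exists b, forall u, m (vec1 u) = I (b * u).
Proof.
move=> [s sE].
(* The 1-cochain is read as a bilinear one whose second argument, undifferentiated, is the constant
   1. *)
have [n [c cE]] := local_diffop_by_parts [seq (t.1, (t.2 ord0, 0%N)) | t <- s].
exists (diffop n.+4 c 1) => u; rewrite mulrC -cE sE.
apply: eq_Rintegral => x _; rewrite big_map vectS1_sum.
apply: eq_bigr => t _; rewrite big_ord1 vectS1M /= mulr1.
by rewrite iter_vectS1_derive.
Qed.

Lemma local2P g : is_local g ->
  exists n c, forall u v, g (vec2 u v) = I (u * diffop n.+4 c v).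
Proof.
move=> [s sE].
have [n [c cE]] :=
  local_diffop_by_parts [seq (t.1, (t.2 ord0, t.2 ord_max)) | t <- s].
exists n, c => u v; rewrite -cE sE.
apply: eq_Rintegral => x _; rewrite big_map vectS1_sum.
apply: eq_bigr => t _; rewrite big_ord_recl big_ord1 !vectS1M /=.
rewrite !iter_vectS1_derive; congr (_ * (_ * _)).
by congr (derive1n (t.2 _) _ _); exact: val_inj.
Qed.

Section Operator.
Variables (g : map_cochain R 2) (L : vectS1 R -> vectS1 R).
Hypothesis gL : forall u v, g (vec2 u v) = I (u * L v).

Lemma alternating2P : (forall u v, L (u + v) = L u + L v) ->
  (Defs.alternating g <-> forall u v, I (u * L v) = - I (v * L u)).
Proof.
move=> LD; split=> [gA u v|gA f i j ij fij].
  have g0 w : I (w * L w) = 0.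
    by rewrite -gL (gA _ ord0 ord_max).
  (* Polarization: the diagonal terms of the form at [u + v] vanish. *)
  have := g0 (u + v).
  rewrite LD mulrDl !mulrDr !circle_intD !g0 add0r addr0 => /eqP.
  by rewrite addr_eq0 => /eqP.
have f01 : f ord0 = f ord_max.
  move: ij fij; rewrite [f]vec2_eta; move: (f ord0) (f ord_max) => u v.
  by case: i j => [[|[|//]] i] [[|[|//]] j].
by have := gA (f ord_max) (f ord_max); rewrite [f]vec2_eta gL f01; lra.
Qed.

(* The cocycle condition says that [L] is a 1-cocycle with values in the
   quadratic differentials, on which [v] acts by [q |-> 2 v' q + v q']. *)
Lemma coboundary2_eq0 : (forall u v, I (u * L v) = - I (v * L u)) ->
  (coboundary g = 0 <-> forall v w, L (bracket v w) =
    D v * L w *+ 2 + v * D (L w) - (D w * L v *+ 2 + w * D (L v))).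
Proof.
move=> LA; have E f : let u := f ord0 in let v := f (lift ord0 ord0) in
    let w := f (lift ord0 (lift ord0 ord0)) in
    coboundary g f = I (u * (L (bracket v w) -
      (D v * L w *+ 2 + v * D (L w) - (D w * L v *+ 2 + w * D (L v))))).
  (* Skew-adjointness in the third term and the adjoint of the bracket in the other two make the
     first argument a common factor. *)
  rewrite /= coboundary2E !gL (LA _ (f ord0)) !circle_int_adjoint_bracket.
  rewrite -!circle_intN -!circle_intD; congr I; ring.
split=> [g0 v w|LE]; last first.
  by apply/funext => f; rewrite E LE subrr mulr0; exact: linear0.
apply/eqP; rewrite -subr_eq0; apply/eqP/circle_int_eq0 => u.
have /= := E (fun k => nth 0 [:: u; v; w] k).
by rewrite g0 => <-.
Qed.

End Operator.
End LowDegree.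

(** * Differential operators satisfying the cocycle condition *)

Section Classification.
Variable R : realType.
Implicit Types (u v w b : vectS1 R) (m : map_cochain R 1) (g : map_cochain R 2)
  (c : nat -> vectS1 R).
Local Notation D := (@vectS1_derive R).
Local Notation Dn n := (iter n (@vectS1_derive R)).
Local Notation I := (@circle_int R).

(** To the order needed, [v] is y - x, and bracketing with this Euler field multiplies the
    derivative of order n by n - 1. *)
Lemma iter_derive_bracket_jet n v w (x : R) :
  (forall i, (i <= n.+1)%N -> Dn i v x = (i == 1%N)%:R) ->
  Dn n (bracket v w) x = (n%:R - 1) * Dn n w x.
Proof.
move=> vx; have v0 : v x = 0 by exact: (vx 0%N).
have v1 : D v x = 1 by exact: (vx 1%N).
rewrite bracketE -scaleN1r iter_deriveD iter_deriveZ vectS1D vectS1Z.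
rewrite (@iter_deriveM_const _ _ _ w (D v)); last first.
  by move=> [//|i] /andP[_ ile]; rewrite -iterSr vx ?ltnS // ltnW.
rewrite v1 mulrBl !mul1r mulN1r; congr (_ - _).
case: n vx => [|n] vx; first by rewrite vectS1M v0 !mul0r.
rewrite iter_deriveM_linear//; last first.
  by move=> i /andP[i1 ile]; rewrite (vx _ (leqW ile)) gtn_eqF.
by rewrite v1 mul1r -iterSr mulr_natl.
Qed.

(** The commutator of [D] with the operator differentiates its coefficients. *)
Lemma derive_diffop n c v :
  D (diffop n c v) = diffop n (D \o c) v + diffop n c (D v).
Proof.
apply: etrans (linear_sum D _ _ _) _; rewrite -big_split.
by apply: eq_bigr => j _; rewrite /= vectS1_deriveM -iterS iterSr.
Qed.

Lemma diffop_jet_delta n c v (x : R) i : (i < n)%N ->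
  (forall j, (j < n)%N -> Dn j v x = (j == i)%:R) -> diffop n c v x = c i x.
Proof.
move=> ilt vx; rewrite diffop_jet (bigD1 (Ordinal ilt)) //= vx// eqxx mulr1.
rewrite big1 ?addr0// => j; rewrite -val_eqE /= vx// => /negPf ->.
by rewrite mulr0.
Qed.

Lemma diffop_cocycle n c :
  let L := diffop n.+4 c in
  (forall v w, L (bracket v w) =
    D v * L w *+ 2 + v * D (L w) - (D w * L v *+ 2 + w * D (L v))) ->
  exists a : R, [/\ D (c 1%N) = c 0%N *+ 2 &
    forall v, L v = c 0%N * v + c 1%N * D v + a *: Dn 3 v].
Proof.
move=> L LE.
have L1 : L 1 = c 0%N.
  rewrite /L /diffop big_ord_recl mulr1 big1 ?addr0// => j _.
  rewrite lift0 iterSr vectS1_derive1.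
  suff -> : Dn j 0 = 0 :> vectS1 R by rewrite mulr0.
  by elim: (val j) => //= k ->; exact: linear0.
(* Bracketing with the constant field 1 is [D], so the cocycle condition at 1 computes the
   commutator of [D] with [L]. *)
have Dc v : diffop n.+4 (D \o c) v = D v * c 0%N *+ 2 + v * D (c 0%N).
  have /eqP := derive_diffop n.+4 c v; rewrite -subr_eq => /eqP <-.
  rewrite -[diffop _ c v]/(L v) -[diffop _ c (D v)]/(L (D v)).
  have := LE 1 v; rewrite bracketE vectS1_derive1 !mul0r subr0 !mul1r L1 => ->.
  by rewrite mul0rn add0r opprB addrC subrK.
have Dcj x j : (j < n.+4)%N ->
    D (c j) x = (j == 1%N)%:R * c 0%N x *+ 2 + (j == 0%N)%:R * D (c 0%N) x.
  (* A field whose only nonzero derivative at [x] has order [j] extracts the coefficient of that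
     order on both sides. *)
  move=> jn; have [v vx] := exists_jet x n.+4 (fun i => (i == j)%:R).
  have := congr1 (fun w : vectS1 R => w x) (Dc v).
  rewrite (diffop_jet_delta _ jn)// => ->.
  by rewrite -[j == 1%N]eq_sym -[j == 0%N]eq_sym -(vx 0%N)// -(vx 1%N).
have D1 : D (c 1%N) = c 0%N *+ 2.
  by apply: vectS1_eq => x; rewrite Dcj// mul1r mul0r addr0.
have D3 : D (c 3) = 0.
  by apply: vectS1_eq => x; rewrite Dcj// !mul0r mul0rn addr0.
have cj j : (1 < j < n.+4)%N -> j != 3 -> c j = 0.
  move=> /andP[j1 jn] j3; apply: vectS1_eq => x.
  (* The jet of [v] is fixed one order further than that of [w], because [iter_derive_bracket_jet]
     needs [v] up to order [n.+1]. *)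
  have [v vx] := exists_jet x n.+4.+1 (fun i => (i == 1%N)%:R).
  have [w wx] := exists_jet x n.+4 (fun i => (i == j)%:R).
  have w0 : w x = 0 by rewrite (wx 0%N)//; case: (j) j1.
  have w1 : D w x = 0 by rewrite (wx 1%N)//; case: (j) j1 => [|[]].
  have := congr1 (fun w : vectS1 R => w x) (LE v w).
  have -> : L (bracket v w) x = (j%:R - 1) * c j x.
    rewrite /L diffop_jet (bigD1 (Ordinal jn)) //=.
    rewrite iter_derive_bracket_jet; last first.
      by move=> i ile; rewrite vx// ltnS (leq_trans ile).
    rewrite wx// eqxx mulr1 mulrC big1 ?addr0// => i.
    rewrite -val_eqE /= => /negPf ij.
    rewrite iter_derive_bracket_jet ?wx ?ij ?mulr0// => k kle.
    by rewrite vx// ltnS (leq_trans kle).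
  have -> : (D v * L w *+ 2 + v * D (L w) -
      (D w * L v *+ 2 + w * D (L v))) x =
    D v x * L w x *+ 2 + v x * D (L w) x -
      (D w x * L v x *+ 2 + w x * D (L v) x) by [].
  rewrite w0 w1 (vx 0%N)// (vx 1%N)// !mul0r mul0rn !addr0 subr0 mul1r.
  rewrite /L (diffop_jet_delta _ jn)// => /eqP; rewrite -subr_eq0.
  have -> : (j%:R - 1) * c j x - c j x *+ 2 = (j%:R - 3%:R) * c j x by ring.
  by rewrite mulf_eq0 subr_eq0 eqr_nat (negPf j3) => /eqP.
(* The coefficient [c 3] is constant, so its value at 0 represents it. *)
exists (c 3 0); split=> // v.
(* The term singled out has order 2; those of order at least 4 are removed by [big1]. *)
rewrite /L /diffop !big_ord_recl [X in c 0%N * _ + (_ + (X + _))](_ : _ = 0).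
  rewrite big1 => [|i _]; last by rewrite !lift0 cj ?mul0r// !ltnS ltn_ord.
  by rewrite add0r addr0 {1}(vectS1_derive_eq0 D3) -scalerAl mul1r addrA.
by rewrite !lift0 cj ?mul0r.
Qed.

End Classification.

(** * The Virasoro class spans the second cohomology *)

Section Virasoro.
Variable R : realType.
Implicit Types (u v w b : vectS1 R) (m : map_cochain R 1) (g : map_cochain R 2).
Local Notation D := (@vectS1_derive R).
Local Notation Dn n := (iter n (@vectS1_derive R)).
Local Notation I := (@circle_int R).

Definition deriveE :=
  (vectS1_deriveD, vectS1_deriveN, vectS1_deriveMn, @vectS1_deriveM R).

(** By [local1P], every local 1-cochain has this form. *)
Definition int_cochain b : map_cochain R 1 := fun f => I (b * f ord0).

Lemma int_cochain_local b : local_cochain (int_cochain b).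
Proof.
split=> [f i a v w|f i j|].
- rewrite /int_cochain ord1 !dfwithin mulrDr -scalerAr.
  by rewrite circle_intD circle_intZ.
- by rewrite !ord1 eqxx.
exists [:: (b, fun=> 0%N)] => f; apply: eq_Rintegral => x _.
by rewrite /diff_op big_seq1 big_ord1.
Qed.

Lemma coboundary_int_cochain b u v :
  coboundary (int_cochain b) (vec2 u v) = - I (u * (b * D v *+ 2 + D b * v)).
Proof.
rewrite coboundary1E /int_cochain mulrC circle_int_adjoint_bracket.
by congr (- I (_ * _)); ring.
Qed.

Lemma local_coboundary1 m : local_cochain m ->
  exists b, coboundary m = coboundary (int_cochain b).
Proof.
move=> [_ _ /local1P[b mb]]; exists b; apply/funext => f.
by rewrite [f]vec2_eta !coboundary1E mb.
Qed.

Lemma multilinear2 g (L : vectS1 R -> vectS1 R) : linear L ->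
  (forall u v, g (vec2 u v) = I (u * L v)) -> multilinear g.
Proof.
move=> Ll gL f i a v w.
have E z : g (dfwith f i z) =
    I (dfwith f i z ord0 * L (dfwith f i z ord_max)).
  by rewrite [LHS](congr1 g (vec2_eta _)) gL.
rewrite !E.
have [->|->] : i = ord0 \/ i = ord_max.
- by case: i {E} => [[|[|//]] i]; [left|right]; exact: val_inj.
- rewrite !dfwithin !dfwithout// mulrDl -scalerAl.
  by rewrite circle_intD circle_intZ.
- rewrite !dfwithin !dfwithout// Ll mulrDr -scalerAr.
  by rewrite circle_intD circle_intZ.
Qed.

Definition vir_op v : vectS1 R := - 2 *: Dn 3 v.

Lemma vir_opE v : vir_op v = - (Dn 3 v *+ 2).
Proof. by rewrite /vir_op scaleNr scaler_nat. Qed.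

Lemma vir_op_linear : linear vir_op.
Proof.
move=> a u v.
by rewrite /vir_op iter_deriveD iter_deriveZ scalerDr !scalerA mulrC.
Qed.

(** One integration by parts in the first term and two in the second each yield minus the integral
    of u v'''. *)
Lemma vir2E u v : vir R (vec2 u v) = I (u * vir_op v).
Proof.
have -> : vir R (vec2 u v) = I (D u * Dn 2 v - D v * Dn 2 u) by [].
rewrite circle_intD circle_intN circle_int_by_parts.
rewrite [D v * _]mulrC [Dn 2 u]iterS circle_int_by_parts circle_int_by_parts.
rewrite /vir_op -scalerAr circle_intZ /=; ring.
Qed.

(** Moving all three derivatives across changes the sign an odd number of times. *)
Lemma vir_op_adjoint u v : I (u * vir_op v) = - I (v * vir_op u).
Proof.
rewrite /vir_op -!scalerAr !circle_intZ -mulrN; congr (_ * _).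
by rewrite mulrC !iterS !circle_int_by_parts !opprK.
Qed.

Lemma vir_cocycle : vir R \in @is_cocycle R 2.
Proof.
apply/asboolP; split; first split.
- exact: multilinear2 vir_op_linear vir2E.
- apply/(alternating2P vir2E); last exact: vir_op_adjoint.
  by move=> u v; have := vir_op_linear 1 u v; rewrite !scale1r.
(* For k = 0, 1 the orders k + 1 give u' v'' and the orders 2 - k give u'' v'. *)
- exists [:: (1 : vectS1 R, fun k : 'I_2 => k.+1);
              (- 1 : vectS1 R, fun k : 'I_2 => (2 - k)%N)] => f.
  apply: eq_Rintegral => x _; rewrite /diff_op !big_cons big_nil.
  rewrite !big_ord_recl !big_ord0 [f]vec2_eta.
  move: (f ord0) (f ord_max) => u v.
  have E (p q r t : R) :
    p * q - r * t = 1 * (p * (q * 1)) + (- 1 * (t * (r * 1)) + 0) by ring.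
  exact: E.
- apply/(coboundary2_eq0 vir2E vir_op_adjoint) => v w.
  rewrite !vir_opE bracketE !iterS /= !deriveE; ring.
Qed.

Lemma cocycle_decomposition g : g \in @is_cocycle R 2 ->
  exists a b, g = a *: vir R + coboundary (int_cochain b).
Proof.
move=> /asboolP[[_ gA /local2P[n [c gL]]] gc].
have gAd := (alternating2P gL (@diffopD _ _ c)).1 gA.
have [a [D1 LE]] := diffop_cocycle ((coboundary2_eq0 gL gAd).1 gc).
(* With this half, the lower-order part of the operator is 2 h v' + h' v, the shape found in
   [coboundary_int_cochain]. *)
pose h := 2^-1 *: c 1%N; have c1E : c 1%N = h *+ 2.
  by rewrite -scaler_nat /h scalerA divff ?pnatr_eq0// scale1r.
have c0E : c 0%N = D h.
  have : 2 *: c 0%N = 2 *: D h by rewrite !scaler_nat -D1 c1E vectS1_deriveMn.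
  by move=> /scalerI; apply; rewrite pnatr_eq0.
(* The first witness offsets the factor -2 in [vir_op], the second the sign in
   [coboundary_int_cochain]. *)
exists (- (a / 2)), (- h); apply/funext => f.
rewrite [f]vec2_eta gL LE; move: (f ord0) (f ord_max) => u v.
transitivity (- (a / 2) * vir R (vec2 u v) +
  coboundary (int_cochain (- h)) (vec2 u v)); last by [].
rewrite coboundary_int_cochain vir2E -circle_intZ -circle_intN -circle_intD.
congr I; rewrite /vir_op -scalerAr scalerA.
have -> : - (a / 2) * - 2 = a by field.
rewrite c0E c1E deriveE mulrDr -scalerAr; ring.
Qed.

Lemma vir_not_coboundary b : vir R <> coboundary (int_cochain b).
Proof.
(* At 0 this jet kills the first-order operator of the coboundary while [vir_op] takes the value
   -2. *)
move=> E; have [v vx] := exists_jet (0 : R) 4 (fun j => (j == 3)%:R).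
have : vir_op v + (b * D v *+ 2 + D b * v) = 0.
  apply: circle_int_eq0 => u; rewrite mulrDr circle_intD -vir2E E.
  by rewrite coboundary_int_cochain addNr.
move/(congr1 (fun w : vectS1 R => w 0)).
rewrite /vir_op [_ * _ *+ 2]mulr2n !vectS1D vectS1Z !vectS1M vx//.
rewrite (vx 0%N)// (vx 1%N)// !mulr0 !addr0 mulr1 vectS1_0 => /eqP.
by rewrite oppr_eq0 pnatr_eq0.
Qed.

Definition vir_class : cocycle R 2 := Cocycle vir_cocycle.

Lemma cohomology_classE (z y : cocycle R 2) :
  cohomology_class z = cohomology_class y <->
  exists b, cocycle_val z = cocycle_val y + coboundary (int_cochain b).
Proof.
have E : cocycle_val (z - y) = cocycle_val z - cocycle_val y by [].
rewrite /cohomology_class; split=> [/quotmod_piP/asboolP[m ml]|[b zy]].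
  rewrite E => /eqP; rewrite subr_eq => /eqP ->.
  by have [b ->] := local_coboundary1 ml; exists b; rewrite addrC.
apply/quotmod_piP/asboolP; exists (int_cochain b).
  exact: int_cochain_local.
by rewrite E zy addrC addKr.
Qed.

Lemma vir_class_neq0 : cohomology_class vir_class != 0.
Proof.
apply/eqP => v0; have : cohomology_class vir_class = cohomology_class 0.
  by rewrite v0 /cohomology_class linear0.
move=> /cohomology_classE[b]; rewrite add0r; exact: vir_not_coboundary.
Qed.

Lemma vir_class_span (c : H_GF R 2) :
  exists a : R, c = a *: cohomology_class vir_class.
Proof.
elim/quotmod_ind: c => z; have [a [b zE]] := cocycle_decomposition (cocycleP z).
exists a; rewrite -[RHS]linearZ; apply/cohomology_classE; exists b.
exact: zE.
Qed.

End Virasoro.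

(** Choice picks a coordinate along [e] for each vector; it is unique because [e] is nonzero, and
    uniqueness makes it linear. [Vector.axiom] carries the coordinate map as data, hence
    [inhabited]. *)
Lemma vector_axiom_line (K : fieldType) (V : lmodType K) (e : V) : e != 0 ->
  (forall v, exists a, v = a *: e) -> inhabited (Vector.axiom 1 V).
Proof.
move=> e0 eV; have [f fE] := choice eV.
have f_uniq a v : v = a *: e -> f v = a.
  rewrite {1}(fE v) => /eqP; rewrite -subr_eq0 -scalerBl scaler_eq0 (negPf e0).
  by rewrite orbF subr_eq0 => /eqP.
constructor; exists (fun v => const_mx (f v)).
  move=> a u v; apply/rowP => i; rewrite !mxE; apply: f_uniq.
  by rewrite scalerDl -scalerA -!fE.
exists (fun r : 'rV_1 => r 0 0 *: e) => [v|r]; first by rewrite mxE -fE.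
by apply/rowP => i; rewrite mxE ord1; exact: f_uniq.
Qed.

Theorem propositionA3 (R : realType) :
  exists z : cocycle R 2,
    [/\ (z : map_cochain R 2) = vir R,
        inhabited (Vector.axiom 1 (H_GF R 2)) &
        forall c : H_GF R 2, exists a : R, c = a *: cohomology_class z].
Proof.
exists (vir_class R); split=> //; last exact: vir_class_span.
exact: vector_axiom_line (vir_class_neq0 R) (@vir_class_span R).
Qed.
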